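(* Let $\mathcal A$ be an almost disjoint family on an infinite countable set and let $\phi:\Psi(\mathcal A)\to 2^\omega$ be a continuous function such that $\phi|_{\mathcal A}$ is injective. If $\phi[\mathcal A]$ does not contain a perfect set (a non-empty closed subset of $2^\omega$ without isolated points), then $\mathcal A$ is totally semi-proximal.
   Context: An almost disjoint family on an infinite countable set $N$ is a collection $\mathcal A$ of infinite subsets of $N$ any two distinct members of which have finite intersection. Its $\Psi$-space $\Psi(\mathcal A)$ is the (disjoint) union $N\cup\mathcal A$, topologized so that $N$ is open and discrete and, for $a\in\mathcal A$, the sets $\{a\}\cup (a\setminus F)$, $F\subseteq N$ finite, form a local basis at $a$. Proximal game on a uniform space $(Z,\mathbb U)$: for an entourage $U$ write $U[x]=\{y\in Z : (x,y)\in U\}$. At inning $0$ Player I plays $U_0\in\mathbb U$ and Player II plays $x_0\in Z$; at inning $n+1$ Player I plays $U_{n+1}\in\mathbb U$ with $U_{n+1}\subseteq U_n$ and Player II plays $x_{n+1}\in U_n[x_n]$. Player I wins if $(x_n)_{n\in\omega}$ converges in the topology induced by $\mathbb U$ or $\bigcap_{n\in\omega}U_n[x_n]=\emptyset$; otherwise Player II wins. $(Z,\mathbb U)$ is semi-proximal if Player II has no winning strategy. A strategy for Player II assigns a legal move to each finite sequence of moves of Player I; it is winning if Player II wins every run following it. A topological space is totally semi-proximal if there is a totally bounded uniformity $\mathbb U$ inducing its topology (totally bounded: for every $U\in\mathbb U$ there is a finite $F$ with $Z=\bigcup_{x\in F}U[x]$) for which the uniform space is semi-proximal. An almost disjoint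 family is called totally semi-proximal if its $\Psi$-space is. *)

(* Defs.v *)
From HB Require Import structures.
From mathcomp Require Import all_boot all_order all_algebra.
From mathcomp Require Import all_classical all_reals all_analysis.
From mathcomp Require Import cantor.

Set Implicit Arguments.
Unset Strict Implicit.
Unset Printing Implicit Defensive.

Local Open Scope classical_set_scope.

Definition almost_disjoint (N : Type) (A : set (set N)) : Prop :=
  (forall a, A a -> infinite_set a) /\
  (forall a b, A a -> A b -> a <> b -> finite_set (a `&` b)).

(* The disjoint union of N and A: [inl n] is the isolated point n, and [inr a]
   is the member [val a] of A viewed as a point. *)
Definition psi_space (N : choiceType) (A : set (set N)) : Type := (N + A)%type.

HB.instance Definition _ (N : choiceType) (A : set (set N)) :=
  Choice.copy (psi_space A) (N + A)%type.

Definition psi_isolated (N : choiceType) (A : set (set N)) (n : N) :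
  psi_space A := inl n.

Definition psi_member (N : choiceType) (A : set (set N)) (a : A) :
  psi_space A := inr a.

Definition psi_basic (N : choiceType) (A : set (set N)) (a : A) (F : set N) :
    set (psi_space A) :=
  psi_member a |` (@psi_isolated N A @` (val a `\` F)).

Definition psi_nbhs (N : choiceType) (A : set (set N)) (x : psi_space A) :
    set_system (psi_space A) :=
  match x with
  | inl n => [set U | U (psi_isolated A n)]
  | inr a => filter_from finite_set (psi_basic a)
  end.

HB.instance Definition _ (N : choiceType) (A : set (set N)) :=
  hasNbhs.Build (psi_space A) (@psi_nbhs N A).

Section PsiTopology.
Variables (N : choiceType) (A : set (set N)).

Let psi_nbhs_filter (x : psi_space A) : ProperFilter (nbhs x).
Proof.
case: x => [n|a].
  by apply: Build_ProperFilter_ex => [P Pn|]; [exists (psi_isolated A n) |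
    split => // P Q PQ /PQ].
apply: filter_from_proper; last by move=> F _; exists (psi_member a); left.
apply: filter_from_filter; first by exists set0; exact: finite_set0.
move=> F G finF finG; exists (F `|` G); first by rewrite finite_setU.
move=> _ [->|[n [an FGn] <-]]; first by split; left.
by split; right; exists n => //; split => // ?; apply: FGn; [left|right].
Qed.

Let psi_nbhs_singleton (x : psi_space A) (U : set (psi_space A)) :
  nbhs x U -> U x.
Proof. by case: x => [n //|a] [F _ FU]; apply: FU; left. Qed.

Let psi_nbhs_nbhs (x : psi_space A) (U : set (psi_space A)) :
  nbhs x U -> nbhs x (nbhs^~ U).
Proof.
case: x => [n //|a] [F finF FU]; exists F => // _ [->|[n aFn <-]].
  by exists F.
by apply: FU; right; exists n.
Qed.

HB.instance Definition _ := Nbhs_isNbhsTopological.Build (psi_space A)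
  psi_nbhs_filter psi_nbhs_singleton psi_nbhs_nbhs.

End PsiTopology.

(* Legal sequences of moves of Player I: decreasing sequences of entourages. *)
Definition legal_position (Z : uniformType) (s : seq (set (Z * Z))) : Prop :=
  (forall i, (i < size s)%N -> entourage (nth setT s i)) /\
  (forall i, (i.+1 < size s)%N -> nth setT s i.+1 `<=` nth setT s i).

Definition legal_run (Z : uniformType) (U : nat -> set (Z * Z)) : Prop :=
  (forall n, entourage (U n)) /\ (forall n, U n.+1 `<=` U n).

(* [sigma [:: U_0; ...; U_n]] is the point x_n that Player II plays at inning n;
   the value of [sigma] on [::] is irrelevant. The constraint on x_{n+1} involves
   the previous entourage U_n, not U_{n+1}. *)
Definition legal_strategy (Z : uniformType) (sigma : seq (set (Z * Z)) -> Z) :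
    Prop :=
  forall (s : seq (set (Z * Z))) (U V : set (Z * Z)),
    legal_position (rcons (rcons s U) V) ->
    xsection U (sigma (rcons s U)) (sigma (rcons (rcons s U) V)).

Definition answers (Z : uniformType) (sigma : seq (set (Z * Z)) -> Z)
    (U : nat -> set (Z * Z)) : nat -> Z :=
  fun n => sigma (mkseq U n.+1).

Definition player1_wins (Z : uniformType) (U : nat -> set (Z * Z))
    (x : nat -> Z) : Prop :=
  (exists z : Z, x @ \oo --> z) \/
  \bigcap_(n in [set: nat]) xsection (U n) (x n) = set0.

Definition winning_strategy (Z : uniformType)
    (sigma : seq (set (Z * Z)) -> Z) : Prop :=
  legal_strategy sigma /\
  forall U, legal_run U -> ~ player1_wins U (answers sigma U).

Definition semi_proximal (Z : uniformType) : Prop :=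
  ~ exists sigma : seq (set (Z * Z)) -> Z, winning_strategy sigma.

Definition totally_bounded (Z : uniformType) : Prop :=
  forall U : set (Z * Z), entourage U ->
    exists2 F : set Z, finite_set F &
      \bigcup_(x in F) xsection U x = [set: Z].

(* The equation says that the topological space underlying the uniform space Z
   is X itself, i.e. that the uniformity of Z induces the topology of X. *)
Definition totally_semi_proximal (X : topologicalType) : Prop :=
  exists Z : uniformType,
    [/\ Z = X :> topologicalType, totally_bounded Z & semi_proximal Z].

Definition totally_semi_proximal_family (N : choiceType) (A : set (set N)) :
  Prop := totally_semi_proximal (psi_space A).

(* Main.v *)
(** Give Psi(A) the uniformity generated by all finite clopen partitions; it is
    totally bounded and induces the topology. Suppose Player II has a winning
    strategy there. At inning n let Player I ask Player II to respect the n-th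
    coordinate of phi, the n-th point of N, and the clopen set {b} u b for some
    b in A of Player I's choice. Then phi(x_n) converges, and since Player II
    wins, its limit is phi(a) for a member a that was never chosen as b. Hence
    the continuation of any position in which that a is chosen has a different
    limit. Branching repeatedly in this way yields a Cantor scheme of runs
    whose limits form a perfect subset of phi[A]. *)

From HB Require Import structures.
Require Import Defs.
From mathcomp Require Import all_boot all_order all_algebra.
From mathcomp Require Import all_classical all_reals all_analysis.
From mathcomp Require Import cantor.

Local Open Scope classical_set_scope.

(** * Perfect subsets of the Cantor space *)

Lemma cantor_coord_near (f : cantor_space) (k : nat) :
  \forall g \near f, g k = f k.
Proof.
exact: (@proj_continuous nat (fun=> bool) k f _ (discrete_set1 (f k))).
Qed.

Lemma cantor_prefix_near (f : cantor_space) (n : nat) :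
  \forall g \near f, forall k, (k < n)%N -> g k = f k.
Proof.
elim: n => [|n IH]; first by near=> g => k; rewrite ltn0.
near=> g => k; rewrite ltnS leq_eqVlt => /predU1P[->|].
  by near: g; exact: cantor_coord_near.
by move: k; near: g.
Unshelve. all: by end_near. Qed.

Lemma cantor_continuous (T : topologicalType) (g : T -> cantor_space) :
  (forall x k, \forall y \near x, g y k = g x k) -> continuous g.
Proof.
move=> gk x; apply/cvg_sup => k.
move=> U /= [V [[W _ <-] Wx] /filterS]; apply.
by apply: filterS (gk x k) => y /= gyk; rewrite /preimage /= gyk.
Qed.

(** Compactness makes the range closed. Every [x] is a limit point of the Cantor space, and
    injectivity keeps the images of nearby points distinct from [g x]. *)
Lemma perfect_range_cantor (g : cantor_space -> cantor_space) :
  continuous g -> injective g -> perfect_set (range g).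
Proof.
move=> cg ig; have [_ limT] := cantor_perfect.
have clg : closed (range g).
  apply: compact_closed; first exact: cantor_space_hausdorff.
  apply: continuous_compact cantor_space_compact.
  exact: continuous_subspaceT.
split=> //; apply/seteqP; split => [y /subset_limit_point|_ [x _ <-] U /cg nU].
  by rewrite -(proj1 (closure_id _) clg).
have : limit_point [set: cantor_space] x by rewrite limT.
move=> /(_ _ nU)[y [yx _ Ugy]]; exists (g y); split => //.
by apply: contra_neq yx => /ig.
Qed.

(* [p] is only required to be non-constant on every cylinder; extending
   prefixes beyond an index that separates the two values makes the map from
   binary branches to values of [p] injective. *)
Lemma cantor_scheme (T : Type) (e0 : nat -> T)
    (p : (nat -> T) -> cantor_space) :
  (forall e e' k, (forall j, (j <= k)%N -> e j = e' j) -> p e k = p e' k) ->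
  (forall e m, exists2 e', forall j, (j < m)%N -> e' j = e j & p e' <> p e) ->
  exists P : set cantor_space,
    [/\ P !=set0, perfect_set P & P `<=` range p].
Proof.
move=> p_prefix p_split.
have /choice[alt altP] : forall em : (nat -> T) * nat, exists ek : (nat -> T) * nat,
    (forall j, (j < em.2)%N -> ek.1 j = em.1 j) /\ p ek.1 ek.2 <> p em.1 ek.2.
  move=> [e m]; have [e' ee' pe] := p_split e m.
  have [k pk] : exists k, p e' k <> p e k.
    by apply/existsNP => pk; apply: pe; apply/funext.
  by exists (e', k).
(* A node is a sequence with the length of its frozen prefix. Both children freeze it beyond the
   separating index, so [p] at that index is settled for all descendants. *)
pose step em (b : bool) :=
  (if b then (alt em).1 else em.1, (maxn em.2 (alt em).2).+1).
pose node (f : nat -> bool) := fix node n :=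
  if n is n'.+1 then step (node n') (f n') else (e0, 0%N).
have node_ge f n : (n <= (node f n).2)%N.
  elim: n => //= n IH; rewrite ltnS; exact: leq_trans IH (leq_maxl _ _).
have node_agree f n m j : (n <= m)%N -> (j < (node f n).2)%N ->
    (j < (node f m).2)%N /\ (node f m).1 j = (node f n).1 j.
  move=> + jn; elim: m => [|m IH]; first by rewrite leqn0 => /eqP <-.
  rewrite leq_eqVlt => /predU1P[<- //|/IH[jm <-]] /=; split.
    by rewrite ltnS; apply: leq_trans (ltnW jm) (leq_maxl _ _).
  by case: (f m) => //; exact: (altP _).1.
have node_prefix f f' n : (forall j, (j < n)%N -> f j = f' j) ->
    node f n = node f' n.
  elim: n => //= n IH ff'; rewrite IH ?ff'//.
  by move=> j jn; apply: ff'; exact: ltnW.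
(* Level [n.+1] has frozen at least [n.+1] terms, so term [n] no longer changes. *)
pose branch f : nat -> T := fun n => (node f n.+1).1 n.
have branchE f n j : (j < (node f n).2)%N -> branch f j = (node f n).1 j.
  move=> jn; rewrite /branch; have [nj|jn'] := leqP n j.+1.
    by have [] := node_agree f n j.+1 j nj jn.
  by have [] := node_agree f j.+1 n j (ltnW jn') (node_ge f j.+1).
pose g (f : cantor_space) : cantor_space := p (branch f).
have gE f n k : (k < (node f n).2)%N -> g f k = p (node f n).1 k.
  move=> kn; apply: p_prefix => j jk; apply: branchE.
  exact: leq_ltn_trans kn.
exists (range g); split; first by exists (g point); exists point.
- apply: perfect_range_cantor.
    apply: cantor_continuous => f k; near=> f'.
    rewrite (gE f' k.+1)// (gE f k.+1)//; congr (p (_ _) _).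
    apply: node_prefix; near: f'; exact: cantor_prefix_near.
  move=> f f' gff'; apply: contrapT => /eqP ff'.
  have ex : exists n, f n != f' n.
    have [//|/forallNP nff'] := pselect (exists n, f n != f' n).
    by exfalso; move/eqP: ff'; apply; apply/funext => n; apply/eqP/negPn/negP.
  (* At the first disagreement [n] both branches are at the same node and take different children,
     whose values under [p] differ at the separating index. *)
  case: (ex_minnP ex) => n nn nmin.
  have nodeE : node f n = node f' n.
    apply: node_prefix => j jn; apply/eqP; apply: contraTT jn => /nmin.
    by rewrite -leqNgt.
  set em := node f n in nodeE; set k := (alt em).2.
  have gk h : node h n = em -> g h k = p (if h n then (alt em).1 else em.1) k.
    by move=> hn; rewrite (gE h n.+1)/= ?hn// ltnS leq_maxr.
  have := congr1 (fun h : cantor_space => h k) gff'; rewrite !gk//.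
  have := (altP em).2; move: nn; rewrite -/k.
  by case: (f n) (f' n) => [] [] //= _ /[swap] ->.
- by move=> _ [f _ <-]; exists (branch f).
Unshelve. all: by end_near. Qed.

(** * The uniformity of finite clopen partitions *)

Definition locally_constant (X : topologicalType) (U : Type) (f : X -> U) :=
  forall x, \forall y \near x, f y = f x.
Arguments locally_constant {X U}.

Definition clopen_base (X : topologicalType) :=
  forall (x : X) (U : set X), nbhs x U ->
    exists f : X -> bool, [/\ locally_constant f, f x & [set y | f y] `<=` U].

Definition eq_kernel (X U : Type) (f : X -> U) : set (X * X) :=
  [set xy | f xy.1 = f xy.2].
Arguments eq_kernel {X U}.

Definition profile (X : Type) (s : seq (X -> bool)) (x : X) : seq bool :=
  [seq f x | f <- s].
Arguments profile {X}.

(** A list of Boolean functions codes the finite partition into fibres of its [profile]; local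
    constancy makes these fibres clopen. *)
Definition clopen_entourage (X : topologicalType) : set_system (X * X) :=
  filter_from [set s | locally_constant (profile s)]
              (fun s => eq_kernel (profile s)).
Arguments clopen_entourage : clear implicits.

(** The proof argument lets the uniform structure on this alias use that the partitions induce the
    topology. *)
Definition clopen_uniform (X : topologicalType) (_ : clopen_base X) : Type := X.

Section ClopenUniform.
Context {X : topologicalType} (baseX : clopen_base X).

Local Notation Z := (clopen_uniform X baseX).

HB.instance Definition _ := Topological.copy Z X.

Let entF : Filter (clopen_entourage X).
Proof.
apply: filter_from_filter; first by exists [::] => x; apply: nearW.
move=> s t cs ct; exists (s ++ t).
  move=> x; apply: filterS2 (cs x) (ct x) => y.
  by rewrite /profile !map_cat => -> ->.
move=> [x y]; rewrite /eq_kernel /profile /= !map_cat => /eqP.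
by rewrite eqseq_cat ?size_map// => /andP[/eqP ? /eqP].
Qed.

Let ent_refl A : clopen_entourage X A -> diagonal `<=` A.
Proof. by move=> [s _ sA] [x y] /diagonalP <-; exact: sA. Qed.

Let ent_inv A : clopen_entourage X A -> clopen_entourage X (A^-1)%relation.
Proof. by move=> [s cs sA]; exists s => // -[x y] /= xy; apply: sA. Qed.

Let ent_split A : clopen_entourage X A ->
  exists2 B, clopen_entourage X B & (B \; B)%relation `<=` A.
Proof.
move=> [s cs sA]; exists (eq_kernel (profile s)); first by exists s.
by move=> [x y] [z /= xz zy]; apply: sA; rewrite /eq_kernel/= xz.
Qed.

Let ent_nbhsE : nbhs = nbhs_ (clopen_entourage X).
Proof.
apply/funext => x; apply/seteqP; split => U.
  move=> /baseX[f [cf fx fU]]; exists (eq_kernel (profile [:: f])).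
    by exists [:: f] => // y; apply: filterS (cf y) => z; rewrite /profile/= => ->.
  by move=> y; rewrite /xsection/= inE => -[fxy]; apply: fU; rewrite /= -fxy.
move=> [A [s cs sA] AU]; apply: filterS (cs x) => y yx.
by apply: AU; rewrite /xsection/= inE; apply: sA.
Qed.

HB.instance Definition _ := Nbhs_isUniform_mixin.Build Z
  entF ent_refl ent_inv ent_split ent_nbhsE.

Lemma eq_kernel_entourage (f : X -> bool) :
  locally_constant f -> entourage (eq_kernel f : set (Z * Z)).
Proof.
move=> cf; exists [:: f].
  by move=> y; apply: filterS (cf y) => z; rewrite /profile/= => ->.
by move=> [x y] [].
Qed.

Lemma clopen_uniform_totally_bounded : totally_bounded Z.
Proof.
move=> U [s _ sU].
suff [F finF FP] : exists2 F : set X, finite_set F &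
    forall x, exists2 y, F y & profile s y = profile s x.
  exists F => //; apply/seteqP; split => // x _.
  by have [y Fy yx] := FP x; exists y => //; rewrite /xsection/= inE; exact: sU.
(* Induction on [s] splits the space by the head of the list, so representatives must be found
   inside an arbitrary subset [W]. *)
suff: forall W : set X, exists2 F : set X, finite_set F &
    forall x, W x -> exists2 y, (F `&` W) y & profile s y = profile s x.
  move=> /(_ setT)[F finF FP]; exists F => // x.
  by have [//|y [Fy _] yx] := FP x; exists y.
elim: s {sU} => [|f s IH] W.
  have [->|/set0P[w Ww]] := eqVneq W set0; first by exists set0.
  by exists [set w] => // x _; exists w.
have [F finF FP] := IH (W `&` [set y | f y]).
have [G finG GP] := IH (W `\` [set y | f y]).
exists (F `|` G); first by rewrite finite_setU.
move=> x Wx; case: (boolP (f x)) => fx.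
  have [//|y [Fy [Wy fy]] yx] := FP x.
  by exists y; [split => //; left|rewrite /profile/= fx fy; congr cons].
have [|y [Gy [Wy /negP/negbTE fy]] yx] := GP x; first by split => //; apply/negP.
exists y; first by split => //; right.
by rewrite /profile/= (negbTE fx) fy; congr cons.
Qed.

End ClopenUniform.

(* An equality of structures: it is definitional once X is destructed, because
   the topology of [clopen_uniform] is copied from that of X. *)
Lemma clopen_uniform_topology (X : topologicalType) (baseX : clopen_base X) :
  (clopen_uniform X baseX : uniformType) = X :> topologicalType.
Proof. by case: X baseX => T []. Qed.

(** * Clopen sets and convergence in the Psi-space *)

Section Cells.
Context {N : countType} {A : set (set N)}.

Lemma psi_locally_constant (U : Type) (f : psi_space A -> U) :
  (forall a : A, exists2 F : set N, finite_set F &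
    forall n, val a n -> ~ F n -> f (psi_isolated A n) = f (psi_member a)) ->
  locally_constant f.
Proof.
move=> fP [n|a]; first by [].
have [F finF Ff] := fP a; exists F => // _ [->//|[n [an Fn] <-]].
exact: Ff.
Qed.

Definition psi_cell (z y : psi_space A) : bool :=
  match z with
  | inl n => y == psi_isolated A n
  | inr a => `[< psi_basic a set0 y >]
  end.

Hypothesis adA : almost_disjoint A.

(** Near [a] the exceptional set is [F]; near another member [b] it is the intersection of [a] and
    [b], finite by almost disjointness. *)
Lemma psi_basic_locally_constant (a : A) (F : set N) : finite_set F ->
  locally_constant (fun y => `[< psi_basic a F y >]).
Proof.
move=> finF; apply: psi_locally_constant => b.
have [<-{b}|ab] := eqVneq a b.
  exists F => // n an Fn; congr (asbool _); apply/propext.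
  by split => _; [left|right; exists n].
exists (val a `&` val b).
  apply: adA.2; [exact: set_valP|exact: set_valP|].
  by move=> /val_inj /eqP; exact/negP.
move=> n bn abn; rewrite !asboolF//.
  by case=> [[ba]|[]//]; move: ab; rewrite ba eqxx.
by case=> [//|[m [am _] [mn]]]; apply: abn; rewrite -mn in bn *.
Qed.

Lemma psi_cell_locally_constant (z : psi_space A) :
  locally_constant (psi_cell z).
Proof.
case: z => [m|a]; last exact: psi_basic_locally_constant.
apply: psi_locally_constant => a; exists [set m]; first exact: finite_set1.
by move=> n _ nm; apply/eqP => -[].
Qed.

Lemma psi_cell_refl (z : psi_space A) : psi_cell z z.
Proof. by case: z => [n|a] /=; [exact: eqxx|apply/asboolP; left]. Qed.

Lemma psi_clopen_base : clopen_base (psi_space A).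
Proof.
move=> [n|a] U.
  move=> Un; exists (psi_cell (psi_isolated A n)); split.
  - exact: psi_cell_locally_constant.
  - exact: psi_cell_refl.
  - by move=> y /eqP ->.
move=> [F finF FU]; exists (fun y => `[< psi_basic a F y >]); split.
- exact: psi_basic_locally_constant.
- by apply/asboolP; left.
- by move=> y /asboolP; exact: FU.
Qed.

(** A basic neighbourhood of [a] omits only finitely many isolated points of its cell, and the
    sequence eventually avoids each of them. *)
Lemma psi_cvg_cell (a : A) (x : nat -> psi_space A) :
  (forall m, \forall n \near \oo, x n <> psi_isolated A m) ->
  (\forall n \near \oo, psi_cell (psi_member a) (x n)) ->
  x @ \oo --> psi_member a.
Proof.
move=> xm xa U [F /finite_seqP[s ->] FU].
have xs : \forall n \near \oo, forall m, m \in s -> x n <> psi_isolated A m.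
  elim: s {FU} => [|m s IH]; first by near=> n.
  near=> n => k; rewrite inE => /predU1P[->|]; first by near: n; exact: xm.
  by move: k; near: n.
apply: filterS2 xs xa => n xs /asboolP[xna|[m [am _] xnm]].
  by apply: FU; left.
apply: FU; right; exists m => //; split => // ms; exact: (xs m).
Unshelve. all: by end_near. Qed.

End Cells.

(** * Scheduled runs against a winning strategy *)

Section PlayerOne.
Context {N : countType} {A : set (set N)} (phi : psi_space A -> cantor_space).
Hypothesis adA : almost_disjoint A.
Hypothesis cphi : continuous phi.
Hypothesis iphi : set_inj (range (@psi_member N A)) phi.

Local Notation Z := (clopen_uniform (psi_space A) (psi_clopen_base adA)).

(* [unpickle] enumerates N; it is [None] at the indices that code no point. *)
Definition isolated_test (i : nat) (y : psi_space A) : bool :=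
  if unpickle i is Some m then psi_cell (psi_isolated A m) y else false.

(* The schedule e may also contain isolated points, so that Player I has a legal
   schedule without assuming that A is nonempty. *)
Definition scheduled_move (e : nat -> psi_space A) (n : nat) : set (Z * Z) :=
  [set xy | forall i, (i <= n)%N ->
    [/\ phi xy.1 i = phi xy.2 i,
        isolated_test i xy.1 = isolated_test i xy.2 &
        psi_cell (e i) xy.1 = psi_cell (e i) xy.2]].

Lemma scheduled_move_prefix (e e' : nat -> psi_space A) (n : nat) :
  (forall j, (j <= n)%N -> e j = e' j) ->
  scheduled_move e n = scheduled_move e' n.
Proof.
move=> ee'; apply/seteqP; split => xy Uxy i i_n.
  by rewrite -ee'//; exact: Uxy.
by rewrite ee'//; exact: Uxy.
Qed.

Lemma scheduled_move_legal (e : nat -> psi_space A) :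
  legal_run (scheduled_move e : nat -> set (Z * Z)).
Proof.
have entF : Filter (@entourage Z) by exact: entourage_filter.
split=> n; last by move=> xy Uxy i i_n; apply: Uxy; exact: leqW.
have entT (f : psi_space A -> bool) : locally_constant f ->
    entourage (eq_kernel f : set (Z * Z)).
  exact: eq_kernel_entourage.
have step i : entourage ([set xy | [/\ phi xy.1 i = phi xy.2 i,
        isolated_test i xy.1 = isolated_test i xy.2 &
        psi_cell (e i) xy.1 = psi_cell (e i) xy.2]] : set (Z * Z)).
  have phii : locally_constant (fun y => phi y i).
    by move=> y; exact: cphi (cantor_coord_near (phi y) i).
  have isoi : locally_constant (isolated_test i).
    rewrite /isolated_test; case: (unpickle i) => [m|].
      exact: psi_cell_locally_constant.
    by move=> y; near=> z.
  have celli := psi_cell_locally_constant adA (e i).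
  apply: filterS3 (entT _ phii) (entT _ isoi) (entT _ celli).
  by move=> [x y].
elim: n => [|n IH].
  by apply: filterS (step 0%N) => xy ? i; rewrite leqn0 => /eqP ->.
apply: filterS2 IH (step n.+1) => xy Uxy Kxy i.
by rewrite leq_eqVlt => /predU1P[->//|]; exact: Uxy.
Unshelve. all: by end_near. Qed.

Variable sigma : seq (set (Z * Z)) -> Z.
Hypothesis sigma_wins : winning_strategy sigma.

Definition play (e : nat -> psi_space A) : nat -> psi_space A :=
  answers sigma (scheduled_move e).

(** This diagonal is the limit of [phi (play e n)], since coordinate [k] is constant from inning [k]
    on; it depends on [e] only up to [k] there. *)
Definition trace (e : nat -> psi_space A) : cantor_space :=
  fun k => phi (play e k) k.

Lemma play_prefix (e e' : nat -> psi_space A) (n : nat) :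
  (forall j, (j <= n)%N -> e j = e' j) -> play e n = play e' n.
Proof.
move=> ee'; rewrite /play /answers; congr sigma.
apply/eq_in_map => k; rewrite mem_iota /= add0n ltnS => kn.
by apply: scheduled_move_prefix => j jk; apply: ee'; exact: leq_trans kn.
Qed.

Lemma trace_member (e : nat -> psi_space A) :
  exists2 a : A, trace e = phi (psi_member a) &
    forall i, e i <> psi_member a.
Proof.
have /sigma_wins.2 := scheduled_move_legal e.
rewrite /player1_wins -/(play e) => /not_orP[ncvg /eqP/set0P[z zP]].
(* As Player II wins, some [z] lies in every section. An isolated [z], or a scheduled member, would
   be the limit of the play. *)
have {}zP i n : (i <= n)%N -> [/\ phi (play e n) i = phi z i,
    isolated_test i (play e n) = isolated_test i z &
    psi_cell (e i) (play e n) = psi_cell (e i) z].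
  by move=> i_n; have := zP n I; rewrite /xsection /= inE; apply.
have traceE : trace e = phi z.
  by apply/funext => k; have [] := zP k k (leqnn k).
case: z => [m|a] in zP traceE *.
  exfalso; apply: ncvg; exists (psi_isolated A m).
  move=> U Um; exists (pickle m) => // n /= mn.
  have [_ + _] := zP _ _ mn.
  rewrite /isolated_test pickleK psi_cell_refl => /eqP ->.
  exact: Um.
exists a => // i eia; apply: ncvg; exists (psi_member a).
apply: psi_cvg_cell.
  move=> m; exists (pickle m) => // n /= mn xm.
  have [_ + _] := zP _ _ mn.
  by rewrite /isolated_test pickleK xm psi_cell_refl.
exists i => // n /= i_n; have [_ _] := zP _ _ i_n.
by rewrite eia psi_cell_refl.
Qed.

Lemma winning_strategy_perfect : exists P : set cantor_space,
  [/\ P !=set0, perfect_set P & P `<=` phi @` range (@psi_member N A)].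
Proof.
have [|e m|P [P0 perfP Ptrace]] :=
    (* The value [sigma [::]] only serves as some point for the initial schedule. *)
    @cantor_scheme (psi_space A) (fun=> sigma [::]) trace.
- by move=> e e' k ee'; rewrite /trace (play_prefix _ _ _ ee').
- have [a ea _] := trace_member e.
  (* Scheduling [a] itself from inning [m] on rules it out as the new limit member, and injectivity
     of [phi] then separates the traces. *)
  pose e' j := if (j < m)%N then e j else psi_member a.
  exists e'; first by move=> j jm; rewrite /e' jm.
  have [b eb /(_ m)] := trace_member e'; rewrite /e' ltnn => ab.
  rewrite eb ea => /iphi ba; apply: ab.
  by rewrite ba// inE; eexists.
exists P; split => // p /Ptrace[e _ <-].
have [a -> _] := trace_member e.
by exists (psi_member a) => //; exists a.
Qed.

End PlayerOne.

Theorem proposition2 (N : countType) (A : set (set N))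
    (phi : psi_space A -> cantor_space) :
  infinite_set [set: N] ->
  almost_disjoint A ->
  continuous phi ->
  set_inj (range (@psi_member N A)) phi ->
  (~ exists P : set cantor_space,
      [/\ P !=set0, perfect_set P & P `<=` phi @` range (@psi_member N A)]) ->
  totally_semi_proximal_family A.
Proof.
move=> _ adA cphi iphi noperfect.
exists (clopen_uniform (psi_space A) (psi_clopen_base adA)); split.
- exact: clopen_uniform_topology.
- exact: clopen_uniform_totally_bounded.
- move=> [sigma sigma_wins]; apply: noperfect.
  exact: winning_strategy_perfect cphi iphi sigma sigma_wins.
Qed.
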